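(* Let $\mathcal{H}$ be a real Hilbert space of dimension $2\le n\le\infty$ and consider open sets $\mathcal{X},\mathcal{Y}\subset\mathcal{H}$ where $\mathcal{X}$ is connected. Let $q:\mathcal{X}\times\mathcal{Y}\to(0,\infty)$, $(x,y)\mapsto q(y|x)$, be such that $x\mapsto\nabla_x\log q(y|x)$ exists and is continuous on $\mathcal{X}$ for any $y\in\mathcal{Y}$, and $y\mapsto\nabla_y\log q(y|x)$ exists and is continuous on $\mathcal{Y}$ for any $x\in\mathcal{X}$. For a probability distribution $P$ on $\mathcal{X}$ satisfying $$\mathbb{E}_{X\sim P}\left((1+\|X\|)\,q(y|X)\right)<\infty,\quad\forall y\in\mathcal{Y},\qquad( * )$$ let $\mathcal{Y}_P:=\{y\in\mathcal{Y}:\mathbb{E}_{X\sim P}(q(y|X))>0\}$ and $f_P(y):=\dfrac{\mathbb{E}_{X\sim P}(X\,q(y|X))}{\mathbb{E}_{X\sim P}(q(y|X))}$ for $y\in\mathcal{Y}_P$. If $f_P$ implements a proximity operator for any $P$ satisfying $( * )$, then there exist $c\ge0$, $a\in C^1(\mathcal{X})$ and $b\in C^1(\mathcal{Y})$ such that $$q(y|x)=\exp\left(-a(x)-b(y)+c\langle x,y\rangle\right),\qquad\forall(x,y)\in\mathcal{X}\times\mathcal{Y}.$$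
   Context: $\langle\cdot,\cdot\rangle$ and $\|\cdot\|$ are the inner product and norm of $\mathcal{H}$. A function $f:S\to\mathcal{H}$ with $S\subset\mathcal{H}$ implements a proximity operator if there is a (possibly nonconvex) proper function $\varphi:\mathcal{H}\to\mathbb{R}\cup\{+\infty\}$ (i.e. not identically $+\infty$) such that $f(y)\in\mathrm{prox}_\varphi(y):=\arg\min_{x\in\mathcal{H}}\{\frac12\|y-x\|^2+\varphi(x)\}$ for every $y\in S$. Probability distributions on $\mathcal{X}$ are arbitrary (in particular finite combinations of Dirac masses are allowed). *)

(* Defs.v *)
From HB Require Import structures.
From mathcomp Require Import all_boot all_order all_algebra.
From mathcomp Require Import sesquilinear.
From mathcomp Require Import all_classical all_reals all_analysis.

Set Implicit Arguments.
Unset Strict Implicit.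
Unset Printing Implicit Defensive.

Import Order.TTheory GRing.Theory Num.Theory.
Import numFieldNormedType.Exports.

Local Open Scope classical_set_scope.
Local Open Scope ring_scope.

(* The library has no Hilbert structure: a real Hilbert space is a complete
   normed module H together with a positive definite symmetric bilinear form
   [dot : {dot H for idfun}] whose associated norm is the norm of H. *)
Definition hilbert_dot (R : realType) (H : completeNormedModType R)
    (dot : {dot H for idfun}) : Prop :=
  forall x : H, dot x x = `|x| ^+ 2.

(* Infinite-dimensional spaces satisfy it for every n. *)
Definition dim_ge (R : realType) (H : lmodType R) (n : nat) : Prop :=
  exists e : 'I_n -> H,
    forall k : 'I_n -> R, \sum_i k i *: e i = 0 -> forall i, k i = 0.

Definition borel (T : ptopologicalType) := g_sigma_algebraType (@open T).

(* Gradient in the Frechet sense: the differential of f at x is <g, .>.  For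
   a function of interest only on an open set containing x, the values of f
   outside that set do not matter. *)
Definition is_gradient (R : realType) (H : completeNormedModType R)
    (dot : {dot H for idfun}) (f : H -> R) (x g : H) : Prop :=
  differentiable f x /\ forall h, 'd f x h = dot g h.

(* For open A: the gradient of f exists at every point of A and depends
   continuously on the point. *)
Definition C1_on (R : realType) (H : completeNormedModType R)
    (dot : {dot H for idfun}) (A : set H) (f : H -> R) : Prop :=
  exists2 g : H -> H, {within A, continuous g} &
    forall x, A x -> is_gradient dot f x (g x).

Definition proper_fun (R : realType) (H : Type) (phi : H -> \bar R) : Prop :=
  (forall x, phi x != -oo%E) /\ (exists x, phi x != +oo%E).

Definition prox (R : realType) (H : normedModType R) (phi : H -> \bar R)
    (y : H) : set H :=
  [set x | forall z,
    ((2^-1 * `|y - x| ^+ 2)%:E + phi x <= (2^-1 * `|y - z| ^+ 2)%:E + phi z)%E].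

Definition implements_prox (R : realType) (H : normedModType R) (S : set H)
    (f : H -> H) : Prop :=
  exists2 phi : H -> \bar R, proper_fun phi &
    forall y, S y -> prox phi y (f y).

Section posterior_mean.
Context (R : realType) (H : completeNormedModType R) (dot : {dot H for idfun}).
Variables (X Y : set H) (q : H -> H -> R) (P : probability (borel H) R).

(* [q x y] stands for q(y|x).  A distribution on X is a Borel probability P on
   H with P X = 1, so an expectation is an integral over X. *)
Definition finite_moment : Prop :=
  forall y, Y y -> (\int[P]_(x in X) ((1 + `|x|) * q x y)%:E < +oo)%E.

Definition evidence (y : H) : \bar R := \int[P]_(x in X) (q x y)%:E.

(* Vector-valued integral in the weak (Pettis) sense, H being possibly
   non-separable; it agrees with the Bochner integral when the latter exists.
   For F x = q(y|x) x it exists under [finite_moment], by the Riesz theorem. *)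
Definition is_weak_integral (F : H -> H) (v : H) : Prop :=
  forall h, P.-integrable X (fun x : borel H => (dot (F x) h)%:E) /\
            (\int[P]_(x in X) (dot (F x) h)%:E = (dot v h)%:E)%E.

(* [get] returns a junk value when there is no weak integral. *)
Definition weak_integral (F : H -> H) : H := get (is_weak_integral F).

Definition Y_P : set H := [set y | Y y /\ (0 < evidence y)%E].

(* The value of [fine] is meaningful when the evidence is finite. *)
Definition f_P (y : H) : H :=
  (fine (evidence y))^-1 *: weak_integral (fun x => q x y *: x).

End posterior_mean.

(* Main.v *)
(* Only the distributions P = (delta_x1 + delta_x2) / 2 are needed.  For them
   f_P(y) = x2 + w(y) (x1 - x2), where w is an increasing function of
   g(y) = ln q(y|x1) - ln q(y|x2).  A selection of a proximity operator is
   monotone, so g is nondecreasing along <x1 - x2, .>, and by continuity it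
   depends on y only through <x1 - x2, y>.  Hence the difference of the
   y-gradients at x1 and x2 is a multiple of x1 - x2; in dimension at least 2
   the factor c depends neither on x1, x2 (consider noncollinear triples) nor on
   y (choose x1 - x2 orthogonal to y - y').

   As Y may be disconnected, integrating in y does not suffice.  For fixed y, y'
   the function k(x) = ln q(y|x) - ln q(y'|x) - c <x, y - y'> is invariant under
   displacements of x orthogonal to y - y', and also to z - y' for z close to y,
   since k does not change, up to a constant, when z replaces y.  These
   displacements span H, so k is locally constant on the connected set X. *)

Require Import Defs.
From HB Require Import structures.
From mathcomp Require Import all_boot all_order all_algebra.
From mathcomp Require Import sesquilinear.
From mathcomp Require Import all_classical all_reals all_analysis.
From mathcomp Require Import measurable_realfun ring lra.
Import Order.TTheory GRing.Theory Num.Theory.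
Import numFieldNormedType.Exports.
Local Open Scope classical_set_scope.
Local Open Scope ring_scope.

Set Implicit Arguments.
Unset Strict Implicit.
Unset Printing Implicit Defensive.

(** * Borel measurability and integration against two-point distributions *)

Lemma measurable_bool_fun (d : measure_display) (T : measurableType d)
    (f : bool -> T) : measurable_fun [set: bool] f.
Proof. by []. Qed.

(** Open intervals generate the Borel sets of [R], and their preimages within the open set [D] are
    open. *)
Lemma borel_measurable_fun (R : realType) (T : ptopologicalType) (D : set T)
    (f : T -> R) : open D -> (forall x, D x -> {for x, continuous f}) ->
  measurable_fun (D : set (borel T)) (f : borel T -> R).
Proof.
move=> oD cf mD; apply: (measurability _ (RGenOpens.measurableE R)) => //.
move=> _ [_ [a [b ->] <-]]; apply: sub_sigma_algebra.
rewrite openE => x [Dx fx]; rewrite /interior; apply: filterI.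
  exact: open_nbhs_nbhs.
by apply: (cf _ Dx); apply: open_nbhs_nbhs; split => //; exact: interval_open.
Qed.

Section two_point.
Context (R : realType) (T : ptopologicalType) (x1 x2 : T).

(** The measure (delta_x1 + delta_x2) / 2, encoded as the image of a fair coin toss so that
    integrals reduce to sums over [bool]. *)
Definition two_point : probability (borel T) R :=
  let phi (b : bool) : borel T := if b then x1 else x2 in
  let phim : {mfun bool >-> borel T} :=
    HB.pack phi (isMeasurableFun.Build _ _ _ _ _ (measurable_bool_fun phi)) in
  [the probability _ _ of distribution (bernoulli_prob (2^-1 : R)) phim].

Lemma two_pointE (A : set (borel T)) : A x1 -> A x2 -> two_point A = 1%E.
Proof.
move=> A1 A2; rewrite -(@probability_setT _ _ _ (bernoulli_prob (2^-1 : R))).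
rewrite /two_point /= /distribution /pushforward; congr (bernoulli_prob _ _).
by apply/seteqP; split => // -[].
Qed.

Variables (D : set (borel T)) (mD : measurable D) (D1 : D x1) (D2 : D x2).

Lemma ge0_integral_two_point (f : borel T -> \bar R) :
  measurable_fun D f -> (forall x, D x -> 0 <= f x)%E ->
  (\int[two_point]_(x in D) f x = 2^-1%:E * f x1 + 2^-1%:E * f x2)%E.
Proof.
move=> mf f0; rewrite ge0_integral_pushforward//; last first.
  by move=> x /set_mem; exact: f0.
rewrite (_ : _ @^-1` D = setT); last by apply/seteqP; split => // -[].
rewrite integral_bernoulli_prob; first 1 last.
- by apply/andP; split; lra.
- by move=> -[]; apply: f0.
by rewrite /= /unstable.onem (_ : 1 - 2^-1 = 2^-1 :> R); last lra.
Qed.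

Lemma integral_two_point (f : borel T -> R) : measurable_fun D f ->
  two_point.-integrable D (EFin \o f) /\
  (\int[two_point]_(x in D) (f x)%:E = (2^-1 * (f x1 + f x2))%:E)%E.
Proof.
move=> mf; have mEf : measurable_fun D (EFin \o f) by exact/measurable_EFinP.
split.
  apply/integrableP; split => //.
  rewrite ge0_integral_two_point//; first exact: ltry.
  exact: measurableT_comp.
rewrite integralE ge0_integral_two_point//; last exact: measurable_funepos.
rewrite ge0_integral_two_point//; last exact: measurable_funeneg.
rewrite !funeposE !funenegE /= -!EFin_max -!EFinM -!EFinD; congr (_%:E).
by rewrite /Num.max /Order.max; do 4 case: ifPn; lra.
Qed.

End two_point.

(** * Inner product: orthogonality and continuity *)

Section inner_product.
Context (R : realType) (H : completeNormedModType R) (dot : {dot H for idfun}).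

Lemma dotC u v : dot u v = dot v u.
Proof. by rewrite hermC expr0 mul1r. Qed.

Lemma dotDl u v w : dot (u + v) w = dot u w + dot v w.
Proof. exact: linearDl. Qed.

Lemma dotZl a u w : dot (a *: u) w = a * dot u w.
Proof. exact: linearZl_LR. Qed.

Lemma dotBl u v w : dot (u - v) w = dot u w - dot v w.
Proof. by rewrite dotDl -scaleN1r dotZl mulN1r. Qed.

Lemma dotDr u v w : dot w (u + v) = dot w u + dot w v.
Proof. by rewrite !(dotC w) dotDl. Qed.

Lemma dotBr u v w : dot w (u - v) = dot w u - dot w v.
Proof. by rewrite !(dotC w) dotBl. Qed.

Lemma dotZr a u w : dot w (a *: u) = a * dot w u.
Proof. by rewrite !(dotC w) dotZl. Qed.

Lemma dotNr u w : dot w (- u) = - dot w u.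
Proof. by rewrite -scaleN1r dotZr mulN1r. Qed.

Lemma dot_gt0 u : u != 0 -> 0 < dot u u.
Proof. exact: neq0_dnorm_gt0. Qed.

Lemma dot_eq0 u : dot u u = 0 -> u = 0.
Proof. by move=> u0; apply: contra_eq u0 => /dot_gt0; rewrite lt0r => /andP[]. Qed.

Lemma dot_inj u v : (forall h, dot u h = dot v h) -> u = v.
Proof.
by move=> uv; apply/eqP; rewrite -subr_eq0; apply/eqP/dot_eq0; rewrite dotBl uv subrr.
Qed.

(** The residual of [w] after projection on [d] is orthogonal to [d], hence by hypothesis to [w],
    hence to itself. *)
Lemma parallel_of_orthogonal (w d : H) : d != 0 ->
  (forall h, dot d h = 0 -> dot w h = 0) -> w = (dot w d / dot d d) *: d.
Proof.
move=> d0 dw; have dd := dot_gt0 d0.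
have dh : dot d (w - (dot w d / dot d d) *: d) = 0.
  by rewrite dotBr dotZr divfK ?gt_eqF// dotC subrr.
apply/eqP; rewrite -subr_eq0; apply/eqP/dot_eq0.
by rewrite dotBl dotZl dh (dw _ dh) mulr0 subrr.
Qed.

Lemma exists_orthogonal (u : H) : dim_ge H 2 ->
  exists2 d : H, d != 0 & dot u d = 0.
Proof.
move=> [e he].
pose a i := dot u (e i).
have [a0|a0] := eqVneq (a ord0) 0.
  exists (e ord0) => //; apply/eqP => e0.
  have := he (fun i => (i == ord0)%:R).
  rewrite big_ord_recl big_ord1 /= e0 scaler0 scale0r addr0 => /(_ erefl ord0) /eqP.
  by rewrite eqxx oner_eq0.
(* The coefficients cancel the products with [u]; independence of [e] and [a ord0 != 0] make the
   vector nonzero. *)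
exists (a ord_max *: e ord0 - a ord0 *: e ord_max); last first.
  by rewrite dotBr !dotZr /a mulrC subrr.
apply/eqP => d0.
have := he (fun i => if i == ord0 then a ord_max else - a ord0).
rewrite big_ord_recl big_ord1 /= (_ : lift ord0 ord0 = ord_max); last exact/val_inj.
rewrite scaleNr => /(_ d0 ord_max) /= /eqP.
by rewrite oppr_eq0 (negbTE a0).
Qed.

Hypothesis hdot : hilbert_dot dot.

Lemma dot_continuous h : continuous (dot h).
Proof.
(* Polarization reduces continuity to that of the norm. *)
have -> : dot h = (fun x => 2^-1 * (`|h + x| ^+ 2 - `|x| ^+ 2 - `|h| ^+ 2)).
  apply/funext => x; rewrite -!hdot !dotDl !dotDr (dotC x h); lra.
move=> x; apply: cvgMr; apply: cvgB; last exact: cvg_cst.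
have nn (f : H -> H) : f z @[z --> x] --> f x ->
    `|f z| ^+ 2 @[z --> x] --> `|f x| ^+ 2.
  by move=> fx; rewrite expr2; under eq_fun do rewrite expr2; apply: cvgM; exact: cvg_norm.
by apply: cvgB; [apply: (nn (fun z => h + z)); apply: cvgD; [exact: cvg_cst|exact: cvg_id]
                |apply: (nn id); exact: cvg_id].
Qed.

Lemma dot_is_gradient h x : is_gradient dot (dot h) x h.
Proof.
split; first exact/linear_differentiable/dot_continuous.
by move=> v; rewrite diff_lin//; exact: dot_continuous.
Qed.

End inner_product.

(** * Proximity operators and posterior means of two-point distributions *)

Lemma prox_monotone (R : realType) (H : completeNormedModType R)
    (dot : {dot H for idfun}) (S : set H) (f : H -> H) (y y' : H) :
  hilbert_dot dot -> implements_prox S f -> S y -> S y' ->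
  0 <= dot (f y - f y') (y - y').
Proof.
move=> hdot [phi [phiNy [x0 phix0]] hphi] Sy Sy'.
(* A minimizer does at least as well as [x0], where [phi] is finite. *)
have fin z : S z -> phi (f z) \is a fin_num.
  move=> Sz; have := hphi _ Sz x0; have := phiNy (f z); have := phiNy x0.
  by case: (phi (f z)) => // ; case: (phi x0) phix0.
(* Each value competes in the other's minimization; in the sum of the two inequalities [phi]
   cancels. *)
have := hphi _ Sy (f y'); have := hphi _ Sy' (f y).
move: (fin _ Sy) (fin _ Sy'); case: (phi (f y)) => // a _; case: (phi (f y')) => // b _.
rewrite -!EFinD !lee_fin -!hdot !dotBl !dotBr.
rewrite !(dotC dot _ (f y)) !(dotC dot _ (f y')); lra.
Qed.

Section two_point_estimator.
Context (R : realType) (H : completeNormedModType R) (dot : {dot H for idfun}).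
Variables (X Y : set H) (q : H -> H -> R) (x1 x2 : H).
Hypotheses (hdot : hilbert_dot dot) (oX : open X) (X1 : X x1) (X2 : X x2).
Hypothesis q_gt0 : forall x y, X x -> Y y -> 0 < q x y.
Hypothesis q_cont : forall x y, X x -> Y y -> {for x, continuous (q ^~ y)}.

Let P := two_point R x1 x2.

Let mX : measurable (X : set (borel H)).
Proof. exact: sub_sigma_algebra. Qed.

Lemma finite_moment_two_point : finite_moment X Y q P.
Proof.
move=> y Yy.
have mf : measurable_fun (X : set (borel H))
    ((fun x => (1 + `|x|) * q x y) : borel H -> R).
  apply: borel_measurable_fun => // x Xx; apply: cvgM; last exact: q_cont.
  by apply: cvgD; [exact: cvg_cst|apply: cvg_norm; exact: cvg_id].
by rewrite (integral_two_point mX X1 X2 mf).2 ltry.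
Qed.

Lemma evidence_two_point y : Y y ->
  evidence X q P y = (2^-1 * (q x1 y + q x2 y))%:E.
Proof.
move=> Yy; have mf : measurable_fun (X : set (borel H)) (q ^~ y : borel H -> R).
  by apply: borel_measurable_fun => // x Xx; exact: q_cont.
exact: (integral_two_point mX X1 X2 mf).2.
Qed.

Lemma Y_P_two_point y : Y y -> Y_P X Y q P y.
Proof.
move=> Yy; split => //; rewrite evidence_two_point// lte_fin.
by rewrite mulr_gt0// addr_gt0// q_gt0.
Qed.

Lemma f_P_two_point y : Y y -> f_P dot X q P y =
  x2 + (q x1 y / (q x1 y + q x2 y)) *: (x1 - x2).
Proof.
move=> Yy; rewrite /f_P evidence_two_point//=.
have q1 := q_gt0 X1 Yy; have q2 := q_gt0 X2 Yy.
have wi : is_weak_integral dot X P (fun x => q x y *: x)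
    (2^-1 *: (q x1 y *: x1 + q x2 y *: x2)).
  move=> h.
  have mf : measurable_fun (X : set (borel H))
      ((fun x => dot (q x y *: x) h) : borel H -> R).
    rewrite (_ : (fun x => _) = fun x => q x y * dot h x); last first.
      by apply/funext => x; rewrite dotZl dotC.
    apply: borel_measurable_fun => // x Xx.
    by apply: cvgM; [exact: q_cont|exact: dot_continuous].
  have [intf ->] := integral_two_point mX X1 X2 mf.
  by split => //; rewrite !(dotZl, dotDl).
rewrite /weak_integral; have := @xgetPex _ point _ (ex_intro _ _ wi).
rewrite -/(get _); set v := get _ => wv.
(* Weak integrals are unique, so [get] can only return the explicit one. *)
rewrite -[v](_ : 2^-1 *: (q x1 y *: x1 + q x2 y *: x2) = v); last first.
  by apply: (@dot_inj _ _ dot) => h; apply: EFin_inj; rewrite -(wv h).2 (wi h).2.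
have q12 : q x1 y + q x2 y != 0 by rewrite gt_eqF// addr_gt0.
apply: (@dot_inj _ _ dot) => h.
by rewrite !(dotZl, dotBl, dotDl); field.
Qed.

Lemma ln_ratio_monotone y y' :
  implements_prox (Y_P X Y q P) (f_P dot X q P) -> Y y -> Y y' ->
  0 < dot (x1 - x2) (y - y') ->
  ln (q x1 y') - ln (q x2 y') <= ln (q x1 y) - ln (q x2 y).
Proof.
move=> hP Yy Yy' d0.
have := prox_monotone hdot hP (Y_P_two_point Yy) (Y_P_two_point Yy').
rewrite !f_P_two_point// [_ + _ - _]addrAC opprD addrA subrr add0r.
(* The difference of the estimates is the difference of the weights times [x1 - x2], so the weights
   are ordered; cross-multiplied, this orders the ratios of likelihoods. *)
rewrite [- _ + _]addrC -scalerBl dotZl pmulr_lge0// subr_ge0.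
have q1 := q_gt0 X1 Yy; have q2 := q_gt0 X2 Yy.
have q1' := q_gt0 X1 Yy'; have q2' := q_gt0 X2 Yy'.
rewrite ler_pdivrMr ?addr_gt0// mulrAC ler_pdivlMr ?addr_gt0// => le12.
rewrite lerBlDr addrAC lerBrDr -!lnM ?posrE// ler_ln ?posrE ?mulr_gt0//; lra.
Qed.

End two_point_estimator.

(** * Gradients, directional derivatives and restriction to lines *)

Section gradient.
Context (R : realType) (H : completeNormedModType R) (dot : {dot H for idfun}).

Lemma open_line (A : set H) (a h : H) : open A -> A a ->
  \forall t \near (0 : R), A (a + t *: h).
Proof.
move=> oA Aa; have : a + t *: h @[t --> (0 : R)] --> a.
  rewrite -[X in _ --> X]addr0 -[X in _ --> _ + X](scale0r h).
  by apply: cvgD; [exact: cvg_cst|apply: cvgZr_tmp; exact: cvg_id].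
by apply; exact: open_nbhs_nbhs.
Qed.

Lemma open_line_pos (A : set H) (a h : H) : open A -> A a ->
  exists2 t : R, 0 < t & A (a + t *: h).
Proof.
move=> oA Aa; near (0 : R)^'+ => t; exists t => //.
by near: t; apply: cvg_within; exact: open_line.
Unshelve. all: by end_near. Qed.

Lemma is_gradient_cvg f (y g h : H) : is_gradient dot f y g ->
  t^-1 * (f (y + t *: h) - f y) @[t --> (0 : R)^'+] --> dot g h.
Proof.
move=> [df dfE]; rewrite -dfE -deriveE//.
have /cvg_dnbhs_at_right : t^-1 *: ((f \o shift y) (t *: h) - f y) @[t --> (0 : R)^']
    --> 'D_h f y by exact: diff_derivable.
rewrite (_ : (fun t => _) = fun t => t^-1 * (f (y + t *: h) - f y))//.
by apply/funext => t /=; rewrite [_ + y]addrC.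
Qed.

Lemma is_gradient_line_cvg f (y g h : H) : is_gradient dot f y g ->
  f (y + t *: h) @[t --> (0 : R)^'+] --> f y.
Proof.
move=> [/differentiable_continuous fc _].
apply: (@cvg_comp _ _ _ (fun t : R => y + t *: h) f _ _ _ _ fc).
apply: cvg_at_right_filter; rewrite -[X in _ --> X]addr0 -[X in _ --> _ + X](scale0r h).
by apply: cvgD; [exact: cvg_cst|apply: cvgZr_tmp; exact: cvg_id].
Qed.

(** One-sided difference quotients are compared in the limit. The base points may differ, which
    allows gradients at two points of [Y] to be compared. *)
Lemma le_gradient f1 f2 (y1 y2 g1 g2 h : H) :
  is_gradient dot f1 y1 g1 -> is_gradient dot f2 y2 g2 ->
  (\forall t \near (0 : R)^'+,
     f2 (y2 + t *: h) - f2 y2 <= f1 (y1 + t *: h) - f1 y1) ->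
  dot g2 h <= dot g1 h.
Proof.
move=> /is_gradient_cvg - /(_ h) c1 /is_gradient_cvg - /(_ h) c2 le12.
apply: (ler_cvg_to c2 c1); near=> t.
rewrite ler_pM2l ?invr_gt0//; near: t; first exact: le12.
Unshelve. all: by end_near. Qed.

Lemma is_gradient_sub f1 f2 (y g1 g2 : H) :
  is_gradient dot f1 y g1 -> is_gradient dot f2 y g2 ->
  is_gradient dot (fun z => f1 z - f2 z) y (g1 - g2).
Proof.
move=> [d1 e1] [d2 e2]; split; first exact: differentiableB.
by move=> h; rewrite diffB// dotBl -e1 -e2.
Qed.

Lemma is_gradientZ f (y g : H) a :
  is_gradient dot f y g -> is_gradient dot (fun z => a * f z) y (a *: g).
Proof.
move=> [d e]; split; first exact: differentiableZ.
by move=> h; rewrite (diffZ a d) dotZl -e.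
Qed.

Lemma is_gradient_cst (y : H) a : is_gradient dot (fun=> a) y 0.
Proof.
split; first exact: differentiable_cst.
by move=> h; rewrite diff_cst -(subrr h) dotBl subrr.
Qed.

Lemma gradient_line f (g : H) (y h : H) (t : R) :
  is_gradient dot f (y + t *: h) g ->
  is_derive t 1 (fun s : R => f (y + s *: h)) (dot g h).
Proof.
move=> [df dfE].
have dl : is_diff t (fun s : R => y + s *: h) ( *:%R^~ h).
  rewrite (_ : (fun s => _) = cst y + *:%R^~ h)//.
  by apply: is_diff_eq; rewrite add0r.
have dfl : is_diff t (f \o (fun s : R => y + s *: h)) ('d f (y + t *: h) \o ( *:%R^~ h)).
  exact: is_diff_comp.
apply: DeriveDef; first exact: diff_derivable.
by rewrite deriveE// diff_val /= scale1r dfE.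
Qed.

End gradient.

(** * Locally constant functions and maps with parallel increments *)

Lemma locally_constant_connected (T : topologicalType) (V : Type) (A : set T)
    (f : T -> V) (x0 : T) : open A -> connected A -> A x0 ->
  (forall x, A x -> \forall z \near x, f z = f x) ->
  forall x, A x -> f x = f x0.
Proof.
move=> oA cA A0 fA.
(* Applied to [f x = f x0] and to its negation, this makes the level set of [x0] both open and
   closed in [A]. *)
have op (P : V -> Prop) : open (A `&` [set x | P (f x)]).
  rewrite openE => x [Ax fx]; rewrite /interior.
  have nA : nbhs x A by exact: open_nbhs_nbhs.
  by apply: filterS2 nA (fA _ Ax) => z Az /= fz; split => //=; rewrite fz.
have eA : A `&` [set x | f x = f x0] = A.
  apply: cA; first by exists x0.
    by exists (A `&` [set x | f x = f x0]); [exact: (op (eq^~ (f x0)))|rewrite setIA setIid].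
  exists (~` (A `&` [set x | f x <> f x0])).
    exact/open_closedC/(op (fun v => v <> f x0)).
  apply/seteqP; split => x [Ax /= fx]; split => //=; first by case.
  by apply: contrapT => nfx; apply: fx; split.
by move=> x; rewrite -eA => -[].
Qed.

(* Noncollinear triples [x0], [x], [x'] force equal ratios; two points collinear
   with [x0] are compared through a third one. *)
Lemma parallel_increments_affine (R : realType) (H : completeNormedModType R)
    (dot : {dot H for idfun}) (X : set H) (F : H -> H) (x0 : H) :
  dim_ge H 2 -> open X -> X x0 ->
  (forall x x', X x -> X x' -> exists a : R, F x - F x' = a *: (x - x')) ->
  exists c : R, forall x x', X x -> X x' -> F x - F x' = c *: (x - x').
Proof.
move=> hdim oX X0 hF.
have [e e0 _] := exists_orthogonal dot 0 hdim.
(* The vector [p] witnesses noncollinearity. Pairing [a *: w - a' *: w' = m *: (w - w')] with [p]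
   gives [a' = m], and then [a = m]. *)
have key w w' p a a' : X (x0 + w) -> X (x0 + w') -> w != 0 ->
    dot p w = 0 -> dot p w' != 0 ->
    F (x0 + w) - F x0 = a *: w -> F (x0 + w') - F x0 = a' *: w' -> a = a'.
  move=> Xw Xw' w0 pw pw' Fw Fw'; have [m] := hF _ _ Xw Xw'.
  rewrite -(subrKA (F x0)) Fw -[F x0 - _]opprB Fw' opprD addrACA subrr add0r.
  move=> E; have : dot p (a *: w - a' *: w') = dot p (m *: (w - w')) by rewrite E.
  rewrite !(dotBr, dotZr) pw mulr0 !sub0r mulrN => /oppr_inj /mulIf -/(_ pw') a'm.
  move: E; rewrite a'm scalerBr => /addIr /eqP; rewrite -subr_eq0 -scalerBl.
  by rewrite scaler_eq0 (negbTE w0) orbF subr_eq0 => /eqP.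
have [t t0 Xt] := open_line_pos e oX X0.
have te0 : t *: e != 0 by rewrite scaler_eq0 negb_or gt_eqF.
have [c Fc] := hF _ _ Xt X0; move: Fc; rewrite [x0 + _ - _]addrAC subrr add0r => Fc.
have Fx x : X x -> F x - F x0 = c *: (x - x0).
  move=> Xx; have [->|xx0] := eqVneq x x0; first by rewrite !subrr scaler0.
  have [a Fa] := hF _ _ Xx X0; rewrite Fa; congr (_ *: _).
  have w0 : x - x0 != 0 by rewrite subr_eq0.
  have xE : x = x0 + (x - x0) by rewrite addrC subrK.
  rewrite {1}xE in Fa; rewrite xE in Xx.
  have [p p0 wp] := exists_orthogonal dot (x - x0) hdim; rewrite dotC in wp.
  (* If [p] is not orthogonal to [e], then [x] compares directly with the reference point
     [x0 + t *: e]; otherwise both compare with [x0 + s *: p]. *)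
  have [pe|pe] := eqVneq (dot p e) 0; last first.
    by apply: (key _ _ p _ _ Xx Xt w0 wp) => //; rewrite dotZr mulf_neq0// gt_eqF.
  have [s s0 Xs] := open_line_pos p oX X0.
  have [b Fb] := hF _ _ Xs X0; move: Fb; rewrite [x0 + _ - _]addrAC subrr add0r => Fb.
  have ps0 : dot p (s *: p) != 0 by rewrite dotZr mulf_neq0// gt_eqF// dot_gt0.
  rewrite (key _ _ p _ _ Xx Xs w0 wp ps0 Fa Fb).
  by rewrite (key _ _ p _ _ Xt Xs te0 _ ps0 Fc Fb)// dotZr pe mulr0.
exists c => x x' Xx Xx'.
have -> : F x - F x' = (F x - F x0) - (F x' - F x0) by rewrite opprB addrA subrK.
by rewrite !Fx// -scalerBr opprB addrA subrK.
Qed.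

(** * Rigidity of a log-likelihood [L] with y-gradient [G] *)

Section rigidity.
Context (R : realType) (H : completeNormedModType R) (dot : {dot H for idfun}).
Variables (X Y : set H) (L : H -> H -> R) (G : H -> H -> H).
Hypotheses (hdot : hilbert_dot dot) (hdim : dim_ge H 2).
Hypotheses (oX : open X) (oY : open Y) (cX : connected X).
Hypothesis LG : forall x y, X x -> Y y -> is_gradient dot (L x) y (G x y).
Hypothesis L_mono : forall x1 x2 y y', X x1 -> X x2 -> Y y -> Y y' ->
  0 < dot (x1 - x2) (y - y') -> L x1 y' - L x2 y' <= L x1 y - L x2 y.

Let Lsub x1 x2 y : X x1 -> X x2 -> Y y ->
  is_gradient dot (fun z => L x1 z - L x2 z) y (G x1 y - G x2 y).
Proof. by move=> X1 X2 Yy; apply: is_gradient_sub; exact: LG. Qed.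

(** Moving [y] slightly along [x1 - x2] makes the inner product positive, so [L_mono] applies; the
    limit gives one inequality, and exchanging [y] and [y'] the other. *)
Lemma L_orthogonal x1 x2 y y' : X x1 -> X x2 -> Y y -> Y y' ->
  dot (x1 - x2) (y - y') = 0 -> L x1 y - L x2 y = L x1 y' - L x2 y'.
Proof.
move=> X1 X2.
wlog suff le : y y' / Y y -> Y y' -> dot (x1 - x2) (y - y') = 0 ->
    L x1 y' - L x2 y' <= L x1 y - L x2 y.
  move=> Yy Yy' d0; apply/eqP; rewrite eq_le !le//.
  by rewrite -[y' - y]opprB dotNr d0 oppr0.
move=> Yy Yy' d0; have [->|x12] := eqVneq x1 x2; first by rewrite !subrr.
have d12 : x1 - x2 != 0 by rewrite subr_eq0.
apply: (cvgr_to_ge (is_gradient_line_cvg (x1 - x2) (Lsub X1 X2 Yy))).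
near=> t; apply: L_mono => //; first by near: t; apply: cvg_within; exact: open_line.
by rewrite addrAC dotDr d0 add0r dotZr mulr_gt0 ?dot_gt0.
Unshelve. all: by end_near. Qed.

Lemma gradient_parallel x1 x2 y : X x1 -> X x2 -> Y y ->
  exists a : R, G x1 y - G x2 y = a *: (x1 - x2).
Proof.
move=> X1 X2 Yy; have [->|x12] := eqVneq x1 x2; first by exists 0; rewrite !subrr scaler0.
have d12 : x1 - x2 != 0 by rewrite subr_eq0.
(* Applied to [h] and [- h], this makes the gradient difference orthogonal to everything orthogonal
   to [x1 - x2]. *)
suff le0 h : dot (x1 - x2) h = 0 -> 0 <= dot (G x1 y - G x2 y) h.
  eexists; apply: (@parallel_of_orthogonal _ _ dot) => // h dh.
  apply/eqP; rewrite eq_le le0// andbT -oppr_ge0 -dotNr.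
  by apply: le0; rewrite dotNr dh oppr0.
move=> dh; have -> : 0 = dot 0 h by rewrite -(subrr h) dotBl subrr.
apply: (le_gradient (Lsub X1 X2 Yy) (is_gradient_cst dot y 0)); near=> t.
rewrite subrr subr_ge0 (@L_orthogonal x1 x2 y (y + t *: h))//.
  by near: t; apply: cvg_within; exact: open_line.
by rewrite opprD addrA subrr add0r dotNr dotZr dh mulr0 oppr0.
Unshelve. all: by end_near. Qed.

(** A common displacement of [y] and [y'] preserves [y - y'], so by [L_orthogonal] the function
    [L x1 - L x2] has the same increments at both points. *)
Lemma gradient_orthogonal x1 x2 y y' : X x1 -> X x2 -> Y y -> Y y' ->
  dot (x1 - x2) (y - y') = 0 -> G x1 y - G x2 y = G x1 y' - G x2 y'.
Proof.
move=> X1 X2.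
wlog suff le : y y' / Y y -> Y y' -> dot (x1 - x2) (y - y') = 0 ->
    forall h, dot (G x1 y - G x2 y) h <= dot (G x1 y' - G x2 y') h.
  move=> Yy Yy' d0; apply: (@dot_inj _ _ dot) => h; apply/eqP; rewrite eq_le !le//.
  by rewrite -[y' - y]opprB dotNr d0 oppr0.
move=> Yy Yy' d0 h; apply: (le_gradient (Lsub X1 X2 Yy') (Lsub X1 X2 Yy)); near=> t.
rewrite (L_orthogonal X1 X2 Yy Yy' d0) (@L_orthogonal x1 x2 (y + t *: h) (y' + t *: h))//.
- by near: t; apply: cvg_within; exact: open_line.
- by near: t; apply: cvg_within; exact: open_line.
by rewrite opprD addrACA subrr addr0.
Unshelve. all: by end_near. Qed.

Lemma gradient_affine x0 : X x0 -> exists2 c : R, 0 <= c &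
  forall x1 x2 y, X x1 -> X x2 -> Y y -> G x1 y - G x2 y = c *: (x1 - x2).
Proof.
move=> X0; have [[y0 Y0]|noY] := pselect (exists y, Y y); last first.
  by exists 0 => // x1 x2 y _ _ Yy; case: noY; exists y.
have aff y (Yy : Y y) := parallel_increments_affine dot hdim oX X0
  (fun x1 x2 X1 X2 => gradient_parallel X1 X2 Yy).
have [c Gc] := aff _ Y0.
have XD (u : H) : exists d, [/\ d != 0, dot u d = 0 & X (x0 + d)].
  have [d d0 ud] := exists_orthogonal dot u hdim.
  have [t t0 Xt] := open_line_pos d oX X0; exists (t *: d); split => //.
    by rewrite scaler_eq0 negb_or gt_eqF.
  by rewrite dotZr ud mulr0.
have x0D d : x0 + d - x0 = d by rewrite addrAC subrr add0r.
exists c.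
  (* For the sign of [c], any nonzero displacement [d] will do: [L (x0 + d) - L x0] does not
     decrease along [d]. *)
  have [d [d0 _ Xd]] := XD 0.
  suff : dot 0 d <= dot (G (x0 + d) y0 - G x0 y0) d.
    rewrite Gc// x0D dotZl -(subrr d) dotBl subrr pmulr_lge0//.
    exact: dot_gt0.
  apply: (le_gradient (Lsub Xd X0 Y0) (is_gradient_cst dot y0 0)); near=> t.
  rewrite subrr subr_ge0; apply: L_mono => //.
    by near: t; apply: cvg_within; exact: open_line.
  by rewrite x0D addrAC subrr add0r dotZr mulr_gt0 ?dot_gt0.
suff cE y : Y y -> forall x1 x2, X x1 -> X x2 -> G x1 y - G x2 y = c *: (x1 - x2).
  by move=> x1 x2 y X1 X2 Yy; exact: cE.
move=> Yy; have [c' Gc'] := aff _ Yy.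
suff -> : c = c' by [].
(* A displacement orthogonal to [y - y0] has the same gradient increment at [y] and [y0], which
   forces equal factors. *)
have [d [d0 ud Xd]] := XD (y - y0).
have := Gc' _ _ Xd X0; have := Gc _ _ Xd X0; rewrite x0D => G0 Gy.
apply/eqP; rewrite -subr_eq0 -(orFb (_ == 0)) -(negbTE d0) orbC -scaler_eq0.
by rewrite scalerBl -G0 -Gy (gradient_orthogonal Xd X0 Yy Y0) ?subrr// x0D dotC.
Unshelve. all: by end_near. Qed.

Variable c : R.
Hypothesis Gc : forall x1 x2 y, X x1 -> X x2 -> Y y ->
  G x1 y - G x2 y = c *: (x1 - x2).

(** Mean value theorem: along the segment the derivative is constant by [Gc]. *)
Lemma L_segment x1 x2 y h : X x1 -> X x2 ->
  (forall t : R, 0 <= t <= 1 -> Y (y + t *: h)) ->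
  L x1 (y + h) - L x2 (y + h) - (L x1 y - L x2 y) = c * dot (x1 - x2) h.
Proof.
move=> X1 X2 Yt.
pose f (t : R) := L x1 (y + t *: h) - L x2 (y + t *: h).
have df (t : R) : 0 <= t <= 1 -> is_derive t 1 f (c * dot (x1 - x2) h).
  move=> t01; rewrite -dotZl -(Gc X1 X2 (Yt t t01)).
  exact/(gradient_line (f := fun z => L x1 z - L x2 z))/Lsub/Yt.
have [||t _] := @MVT_segment _ f (fun=> c * dot (x1 - x2) h) 0 1 ler01.
- by move=> t /itvP t01; apply: df; rewrite !ltW ?t01.
- apply: derivable_within_continuous => t; rewrite in_itv /= => t01.
  by have := df _ t01 => dft; exact: ex_derive.
by rewrite /f scale1r scale0r addr0 subr0 mulr1.
Qed.

Lemma L_affine x1 x2 y y' : X x1 -> X x2 -> Y y -> Y y' ->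
  L x1 y - L x2 y - (L x1 y' - L x2 y') = c * dot (x1 - x2) (y - y').
Proof.
move=> X1 X2 Yy Yy'.
have [->|yy'] := eqVneq y y'; first by rewrite dotBr !subrr mulr0.
pose u := y - y'; have u0 : u != 0 by rewrite subr_eq0.
have uu := dot_gt0 dot u0.
pose k x := L x y - L x y' - c * dot x u.
suff kc : forall x, X x -> k x = k x2.
  by have := kc _ X1; rewrite /k dotBl mulrBr -/u; lra.
have [p p0 up] := exists_orthogonal dot u hdim.
have pp := dot_gt0 dot p0.
(* The step [s] keeps the whole segment from [y] to [y + s *: p] inside [Y], as [L_segment]
   requires. *)
have [s s0 Ys] : exists2 s : R, 0 < s &
    forall t : R, 0 <= t <= 1 -> Y (y + t *: (s *: p)).
  have /nbhs_ballP[e /= e0 eY] := open_line p oY Yy.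
  exists (e / 2) => [|t t01]; first by rewrite divr_gt0.
  rewrite scalerA; apply: eY; rewrite /ball /= sub0r normrN ger0_norm; nra.
have ortho x x' : X x -> X x' -> dot (x' - x) u = 0 -> k x' = k x.
  move=> Xx Xx' d0; have := L_orthogonal Xx' Xx Yy Yy' d0.
  by move: d0; rewrite /k dotBl => /eqP; rewrite subr_eq0 => /eqP ->; lra.
pose v := u + s *: p.
(* Here [v] is [(y + s *: p) - y']: [L_orthogonal] is used at [y + s *: p], and [L_segment] leads
   back to [y]. *)
have ortho' x x' : X x -> X x' -> dot (x' - x) v = 0 -> k x' = k x.
  move=> Xx Xx' d0.
  have Yz : Y (y + s *: p) by rewrite -[s *: p]scale1r; apply: Ys; rewrite ler01 lexx.
  have d0' : dot (x' - x) (y + s *: p - y') = 0 by rewrite addrAC.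
  have := L_orthogonal Xx' Xx Yz Yy' d0'; have := L_segment Xx' Xx Ys.
  by move: d0; rewrite /k /v dotDr !dotBl !mulrBr; nra.
(* [u] and [v] are not parallel, so every vector is the sum of one orthogonal
   to [u] and of a multiple of [w], which is orthogonal to [v]. *)
pose w := u - (dot u u / (s * dot p p)) *: p.
have wu : dot w u = dot u u by rewrite dotBl dotZl (dotC _ p) up mulr0 subr0.
have wv : dot w v = 0.
  have wp : dot w p = - (dot u u / (s * dot p p) * dot p p).
    by rewrite dotBl dotZl up sub0r.
  rewrite dotDr wu dotZr wp; field.
  by rewrite !gt_eqF.
apply: (locally_constant_connected oX cX X2) => x Xx.
(* Intermediate point: [z x' - x] is a multiple of [w], hence orthogonal to [v], and [x' - z x'] is
   orthogonal to [u] since [dot w u = dot u u]. It lies in [X] once [x'] is close to [x]. *)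
pose z x' := x + (dot u (x' - x) / dot u u) *: w.
have zc : z x' @[x' --> x] --> x.
  rewrite -[X in _ --> X]addr0 -(scale0r w).
  apply: cvgD; first exact: cvg_cst.
  apply: cvgZr_tmp.
  have -> : 0 = dot u (x - x) / dot u u by rewrite dotBr subrr mul0r.
  apply: cvgMl; apply: (@cvg_comp _ _ _ (fun x' => x' - x) (dot u)).
    by apply: cvgB; [exact: cvg_id|exact: cvg_cst].
  exact: dot_continuous.
near=> x'.
have Xx' : X x' by near: x'; exact: open_nbhs_nbhs.
have Xz : X (z x') by near: x'; apply: zc; exact: open_nbhs_nbhs.
rewrite (ortho (z x') x')//; last first.
  rewrite /z opprD addrA dotBl dotZl wu divfK ?gt_eqF//.
  by rewrite (dotC _ u) subrr.
by apply: ortho' => //; rewrite /z addrAC subrr add0r dotZl wv mulr0.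
Unshelve. all: by end_near. Qed.

End rigidity.

(** * Regularity of [a], [b] and the exponential form of [q] *)

Lemma C1_on_affine_sub (R : realType) (H : completeNormedModType R)
    (dot : {dot H for idfun}) (A : set H) (f : H -> R) (u : H) (c k : R) :
  hilbert_dot dot -> C1_on dot A f ->
  C1_on dot A (fun z => c * dot u z - (f z - k)).
Proof.
move=> hdot [g gc fg]; exists (fun z => c *: u - (g z - 0)).
  move=> z; apply: cvgB; first exact: cvg_cst.
  by apply: cvgB; [exact: gc|exact: cvg_cst].
move=> z Az; apply: is_gradient_sub; first exact/is_gradientZ/dot_is_gradient.
by apply: is_gradient_sub; [exact: fg|exact: is_gradient_cst].
Qed.

Lemma C1_on_cst (R : realType) (H : completeNormedModType R)
    (dot : {dot H for idfun}) (A : set H) (k : R) : C1_on dot A (fun=> k).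
Proof.
by exists (fun=> 0) => [x|x _]; [exact: cvg_cst|exact: is_gradient_cst].
Qed.

Lemma C1_on_ln_continuous (R : realType) (H : completeNormedModType R)
    (dot : {dot H for idfun}) (A : set H) (f : H -> R) (x : H) :
  open A -> (forall z, A z -> 0 < f z) -> C1_on dot A (fun z => ln (f z)) -> A x ->
  {for x, continuous f}.
Proof.
move=> oA f0 [g _ fg] Ax.
have [/differentiable_continuous lnfc _] := fg _ Ax.
(* Near [x] the function [f] is positive, so it agrees with the exponential of its logarithm. *)
have : expR (ln (f z)) @[z --> x] --> expR (ln (f x)).
  by apply: continuous_comp => //; exact: continuous_expR.
rewrite /= lnK ?posrE ?f0//; apply: cvg_trans; apply: near_eq_cvg.
near=> z; rewrite /= lnK// posrE f0//.
by near: z; exact: open_nbhs_nbhs.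
Unshelve. all: by end_near. Qed.

Theorem lemma4 (R : realType) (H : completeNormedModType R)
    (dot : {dot H for idfun}) (hdot : hilbert_dot dot) (hdim : dim_ge H 2)
    (X Y : set H) (oX : open X) (oY : open Y) (cX : connected X)
    (q : H -> H -> R)
    (q_gt0 : forall x y, X x -> Y y -> 0 < q x y)
    (q_C1x : forall y, Y y -> C1_on dot X (fun x => ln (q x y)))
    (q_C1y : forall x, X x -> C1_on dot Y (fun y => ln (q x y)))
    (hprox : forall P : probability (borel H) R,
       P X = 1%E -> finite_moment X Y q P ->
       implements_prox (Y_P X Y q P) (f_P dot X q P)) :
  exists (c : R) (a b : H -> R),
    [/\ 0 <= c, C1_on dot X a, C1_on dot Y b &
      forall x y, X x -> Y y -> q x y = expR (- a x - b y + c * dot x y)].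
Proof.
have trivial : (forall x y, X x -> Y y -> False) ->
    exists (c : R) (a b : H -> R), [/\ 0 <= c, C1_on dot X a, C1_on dot Y b &
      forall x y, X x -> Y y -> q x y = expR (- a x - b y + c * dot x y)].
  move=> XY0; exists 0, (fun=> 0), (fun=> 0).
  by split=> [//|||x y Xx /(XY0 _ _ Xx)//]; exact: C1_on_cst.
have [[x0 X0]|noX] := pselect (exists x, X x); last first.
  by apply: trivial => x y Xx _; apply: noX; exists x.
have [[y0 Y0]|noY] := pselect (exists y, Y y); last first.
  by apply: trivial => x y _ Yy; apply: noY; exists y.
have qc x y : X x -> Y y -> {for x, continuous (q ^~ y)}.
  move=> Xx Yy; apply: (C1_on_ln_continuous oX _ (q_C1x y Yy) Xx) => z Xz.
  exact: q_gt0.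
(* A gradient field is chosen for each [x] in [X]; the value 0 elsewhere is a default. *)
pose G x := if pselect (X x) is left Xx then s2val (cid2 (q_C1y x Xx)) else fun=> 0.
have LG x y : X x -> Y y -> is_gradient dot (fun y => ln (q x y)) y (G x y).
  by rewrite /G; case: pselect => // Xx _ Yy; case: cid2 => g /= _; apply.
have mono x1 x2 y y' : X x1 -> X x2 -> Y y -> Y y' ->
    0 < dot (x1 - x2) (y - y') ->
    ln (q x1 y') - ln (q x2 y') <= ln (q x1 y) - ln (q x2 y).
  move=> X1 X2 Yy Yy'; apply: (ln_ratio_monotone hdot oX X1 X2 q_gt0 qc) => //.
  apply: hprox; first exact: two_pointE.
  exact: finite_moment_two_point.
have [c c0 Gc] := gradient_affine hdim oX oY LG mono X0.
(* Read off by expanding the identity of [L_affine] based at [x0], [y0]; the terms constant in both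
   variables go into [b], and [- 0] only matches the form of [C1_on_affine_sub]. *)
exists c, (fun x => c * dot y0 x - (ln (q x y0) - 0)),
  (fun y => c * dot x0 y - (ln (q x0 y) - (ln (q x0 y0) - c * dot x0 y0))).
split => //.
- by apply: C1_on_affine_sub => //; exact: (q_C1x y0 Y0).
- by apply: C1_on_affine_sub => //; exact: (q_C1y x0 X0).
move=> x y Xx Yy.
have := L_affine hdot hdim oX oY cX LG mono Gc Xx X0 Yy Y0.
rewrite -{2}[q x y]lnK ?posrE ?q_gt0// !dotBl !dotBr => Laff.
by congr expR; rewrite (dotC dot y0); lra.
Qed.
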